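(* Let $\mathcal A$ be a class of powerset modal algebras over a finite alphabet $\mathrm{Al}$. Then the logic $\mathrm{Log}(\mathcal A)$ is locally tabular if and only if $\mathcal A$ is uniformly tunable.
   Context: A powerset $\mathrm{Al}$-algebra is $C=(\mathcal P(X),(g_\Diamond)_{\Diamond\in\mathrm{Al}})$ where each $g_\Diamond:\mathcal P(X)\to\mathcal P(X)$ satisfies $g_\Diamond(\emptyset)=\emptyset$ and $g_\Diamond(U\cup V)=g_\Diamond(U)\cup g_\Diamond(V)$. A formula $\varphi$ is valid in $C$ if $\varphi=X$ under every assignment of subsets to variables ($\Diamond$ interpreted as $g_\Diamond$); $\mathrm{Log}(\mathcal A)$ is the set of formulas valid in all members of $\mathcal A$. A logic is locally tabular if for every $k<\omega$ there are only finitely many pairwise nonequivalent (in the logic) formulas in variables $p_0,\dots,p_{k-1}$. A partition $\mathcal U$ of $X$ is $g$-tuned if for all $U,V\in\mathcal U$: if $V\cap g(U)\neq\emptyset$ then $V\subseteq g(U)$; it is tuned in $C$ if it is $g_\Diamond$-tuned for every $\Diamond$. For $f:\omega\to\omega$, $\mathcal A$ is $f$-tunable if for every $C=(\mathcal P(X),(g_\Diamond))\in\mathcal A$ and every finite partition $\mathcal V$ of $X$ there is a refinement $\mathcal U$ of $\mathcal V$ with $|\mathcal U|\le f(|\mathcal V|)$ that is tuned in $C$; $\mathcal A$ is uniformly tunable if it is $f$-tunable for some $f$. *)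

(* Defs.v *)
From mathcomp Require Import all_boot.
From mathcomp Require Import boolp classical_sets functions cardinality.

Set Implicit Arguments.
Unset Strict Implicit.
Unset Printing Implicit Defensive.

Local Open Scope classical_set_scope.
Local Open Scope card_scope.

(* {bot, imp} is a functionally complete set of Boolean connectives; the other
   connectives are abbreviations. *)
Inductive formula (Al : Type) : Type :=
| Var of nat
| Bot
| Imp of formula Al & formula Al
| Dia of Al & formula Al.

Arguments Var {Al} _.
Arguments Bot {Al}.

Section Formulas.
Variable Al : Type.
Implicit Types phi psi : formula Al.

Definition Neg phi := Imp phi Bot.
Definition And phi psi := Neg (Imp phi (Neg psi)).
Definition Iff phi psi := And (Imp phi psi) (Imp psi phi).

Fixpoint vars_below (k : nat) phi : bool :=
  match phi with
  | Var i => i < k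
  | Bot => true
  | Imp phi1 phi2 => vars_below k phi1 && vars_below k phi2
  | Dia _ phi1 => vars_below k phi1
  end.

(* [S] ranges over all sets of pairwise nonequivalent formulas in p_0, ...,
   p_(k-1). *)
Definition locally_tabular (L : formula Al -> Prop) : Prop :=
  forall (k : nat) (S : set (formula Al)),
    (forall phi, S phi -> vars_below k phi) ->
    (forall phi psi, S phi -> S psi -> phi <> psi -> ~ L (Iff phi psi)) ->
    finite_set S.

End Formulas.

(* Additivity of [op] is binary only: infinite unions need not be preserved. *)
Record powerset_algebra (Al : Type) := PowersetAlgebra {
  carrier : Type;
  op : Al -> set carrier -> set carrier;
  op_set0 : forall d, op d set0 = set0;
  op_setU : forall d U V, op d (U `|` V) = op d U `|` op d V
}.

Section Semantics.
Variable Al : Type.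

Fixpoint eval (C : powerset_algebra Al) (v : nat -> set (carrier C))
    (phi : formula Al) : set (carrier C) :=
  match phi with
  | Var i => v i
  | Bot => set0
  | Imp phi1 phi2 => ~` eval v phi1 `|` eval v phi2
  | Dia d phi1 => op d (eval v phi1)
  end.

Definition valid (C : powerset_algebra Al) (phi : formula Al) : Prop :=
  forall v : nat -> set (carrier C), eval v phi = setT.

Definition Log (A : powerset_algebra Al -> Prop) (phi : formula Al) : Prop :=
  forall C, A C -> valid C phi.

(* A partition is the set of its (nonempty) blocks. *)
Definition is_partition (X : Type) (P : set (set X)) : Prop :=
  partition P id [set: X].

Definition refines (X : Type) (P Q : set (set X)) : Prop :=
  forall U, P U -> exists2 V, Q V & U `<=` V.

Definition tuned_for (X : Type) (g : set X -> set X) (P : set (set X)) : Prop :=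
  forall U V, P U -> P V -> V `&` g U !=set0 -> V `<=` g U.

Definition tuned (C : powerset_algebra Al) (P : set (set (carrier C))) : Prop :=
  forall d : Al, tuned_for (op d) P.

Definition tunable (f : nat -> nat) (A : powerset_algebra Al -> Prop) : Prop :=
  forall C, A C ->
  forall (n : nat) (Q : set (set (carrier C))),
    is_partition Q -> Q #= `I_n ->
    exists P : set (set (carrier C)),
      [/\ is_partition P, refines P Q, P #<= `I_(f n) & tuned P].

Definition uniformly_tunable (A : powerset_algebra Al -> Prop) : Prop :=
  exists f : nat -> nat, tunable f A.

End Semantics.

(* Main.v *)
Require Import Defs.
From HB Require Import structures.
From mathcomp Require Import all_boot.
From mathcomp Require Import boolp classical_sets functions cardinality.

(** If [Log A] is locally tabular, finitely many formulas represent all the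
    formulas in n variables up to equivalence, and their number depends on n
    only. Given a partition into n blocks, let the variables denote the blocks:
    the definable sets form a finite subalgebra whose atoms are the required
    tuned refinement. Conversely, a tuned partition refining the valuation of k
    variables presents the truth sets of all formulas in these variables inside
    a finite algebra of bounded size; there are finitely many such algebras with
    valuation, and equivalence in the logic is implied by agreement in all of
    them. *)

Set Implicit Arguments.
Unset Strict Implicit.
Unset Printing Implicit Defensive.

Local Open Scope classical_set_scope.
Local Open Scope card_scope.

HB.instance Definition _ (Al : Type) := gen_eqMixin (formula Al).
HB.instance Definition _ (Al : Type) := gen_choiceMixin (formula Al).

Section Fibers.
Variables (X T : Type).
Implicit Type h : X -> T.

(** A map into a finite type bounds the number of blocks and encodes unions of blocks as subsets of
    the codomain. Ranging over points of [X] keeps empty preimages out. *)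
Definition fibers h : set (set X) := range (fun x => h @^-1` [set h x]).

Lemma partition_fibers h : is_partition (fibers h).
Proof.
split.
- apply/seteqP; split=> // x _.
  by exists (h @^-1` [set h x]) => //; exists x.
- move=> _ _ [x _ <-] [y _ <-] [z [/= zx zy]].
  by rewrite -zx -zy.
- by move=> _ [x _ <-]; exists x.
Qed.

End Fibers.

Lemma card_fibers (X : Type) (T : finType) (h : X -> T) :
  fibers h #<= `I_#|T|.
Proof.
apply: (@card_le_trans _ _ _ (range (fun i : 'I_#|T| => h @^-1` [set enum_val i]))).
  apply: subset_card_le => _ [x _ <-].
  by exists (enum_rank (h x)) => //; rewrite enum_rankK.
apply: (card_le_trans (card_image_le _ _)).
by have /card_eqPle[] := @card_II #|T|.
Qed.

Lemma partition_indexed (X : Type) (P : set (set X)) (m : nat) :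
  is_partition P -> P #<= `I_m -> exists h : X -> 'I_m, fibers h = P.
Proof.
move=> [coverP trivP neP] /pcard_leP/unsquash f.
have block x : exists U, P U /\ U x.
  by have [U PU Ux] : cover P id x; [rewrite coverP|exists U].
have [B BP] := choice block.
have f_lt x : f (B x) < m by have := @funS _ _ _ _ f _ (BP x).1.
pose h x := Ordinal (f_lt x).
have hE x : h @^-1` [set h x] = B x.
  apply/seteqP; split=> y /=.
    move=> /(congr1 val) /= fE.
    have <- : B y = B x by apply: (@inj _ _ _ f) fE; apply: mem_set; exact: (BP _).1.
    exact: (BP y).2.
  move=> Bxy; apply/val_inj => /=; congr (f _).
  apply: trivP; [exact: (BP _).1|exact: (BP _).1|].
  by exists y; split=> //; exact: (BP y).2.
exists h; apply/seteqP; split=> [_ [x _ <-]|U PU]; first by rewrite hE; exact: (BP x).1.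
have [x Ux] := neP U PU.
exists x => //; rewrite hE; apply: trivP => //; first exact: (BP x).1.
by exists x; split=> //; exact: (BP x).2.
Qed.

Section EvalLemmas.
Variable Al : Type.
Implicit Types (C : powerset_algebra Al) (phi psi : formula Al).

Lemma eval_Neg C (v : nat -> set (carrier C)) phi :
  eval v (Neg phi) = ~` eval v phi.
Proof. by rewrite /= setU0. Qed.

Lemma eval_And C (v : nat -> set (carrier C)) phi psi :
  eval v (And phi psi) = eval v phi `&` eval v psi.
Proof. by rewrite /And !eval_Neg /= setU0 setCU !setCK. Qed.

Lemma LogIffP (A : powerset_algebra Al -> Prop) phi psi :
  Log A (Iff phi psi) <->
  forall C (v : nat -> set (carrier C)), A C -> eval v phi = eval v psi.
Proof.
split=> [L C v AC|E C AC v].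
  have /seteqP[_] := L C AC v; rewrite eval_And /= => I.
  by apply/seteqP; split=> x xE; have [[]// _ []] := I x Logic.I.
rewrite eval_And /= (E C v AC) setIid; exact: setvU.
Qed.

Definition bigAnd (s : seq (formula Al)) := foldr (@And Al) (Neg Bot) s.

Lemma eval_bigAnd C (v : nat -> set (carrier C)) s x :
  eval v (bigAnd s) x <-> forall phi, phi \in s -> eval v phi x.
Proof.
elim: s => [|phi s IH]; first by split=> // _; left; exact: id.
rewrite [bigAnd _]/(And phi (bigAnd s)) eval_And; split=> [[px /IH sx] psi|H].
  by rewrite inE => /orP[/eqP->//|]; exact: sx.
split; first by apply: H; rewrite mem_head.
by apply/IH => psi ps; apply: H; rewrite inE ps orbT.
Qed.

Lemma vars_below_bigAnd k s :
  all (vars_below k) s -> vars_below k (bigAnd s).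
Proof. by elim: s => //= phi s IH /andP[-> /IH ->]. Qed.

End EvalLemmas.

Lemma locally_tabular_representatives (Al : Type)
    (A : powerset_algebra Al -> Prop) (k : nat) :
  locally_tabular (Log A) ->
  exists s : seq (formula Al), all (vars_below k) s /\
    forall phi, vars_below k phi -> exists2 psi, psi \in s &
      forall C (v : nat -> set (carrier C)), A C -> eval v phi = eval v psi.
Proof.
move=> LT.
pose cls phi := [set psi | vars_below k psi /\ Log A (Iff phi psi)].
(* The choice depends on the set [cls phi] only, so equivalent formulas share a representative and
   distinct representatives are nonequivalent. *)
pose rep phi := xget Bot (cls phi).
have repP phi : vars_below k phi -> cls phi (rep phi).
  by move=> kphi; apply: (@xgetI _ _ _ phi); split=> //; apply/LogIffP.
have /finite_seqP[s sE] : finite_set [set rep phi | phi in [set phi | vars_below k phi]].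
  apply: (LT k) => [_ [phi kphi <-]|_ _ [phi kphi <-] [psi kpsi <-] neq].
    by case: (repP _ kphi).
  move=> /LogIffP L; apply: neq.
  have /LogIffP Lphi := (repP _ kphi).2; have /LogIffP Lpsi := (repP _ kpsi).2.
  rewrite /rep; congr (xget _ _); apply/seteqP.
  by split=> chi [kchi /LogIffP Lchi]; split=> //; apply/LogIffP => C v AC;
    rewrite -Lchi // ?Lphi ?Lpsi ?L.
have sP phi : phi \in s <-> [set rep phi | phi in [set phi | vars_below k phi]] phi.
  by rewrite sE.
exists s; split; first by apply/allP => phi /sP[psi kpsi <-]; exact: (repP _ kpsi).1.
move=> phi kphi; exists (rep phi); first by apply/sP; exists phi.
by apply/LogIffP; exact: (repP _ kphi).2.
Qed.

Lemma locally_tabular_tunable (Al : Type) (A : powerset_algebra Al -> Prop) :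
  locally_tabular (Log A) -> uniformly_tunable A.
Proof.
move=> LT.
have [s sP] := choice (fun k => locally_tabular_representatives k LT).
(* A block will be determined by which of the representatives in [s n] hold on it. *)
exists (fun n => #|{set 'I_(size (s n))}|) => C AC n Q Qpart /card_eqPle[+ _].
move=> /pcard_surjP[v Qv].
have [s_below s_rep] := sP n; set t := s n in s_below s_rep *.
pose code x := [set i : 'I_(size t) | `[< eval v (nth Bot t i) x >]]%SET.
(* Every definable set is a union of fibers of [code], as [phi] agrees with some member of [t]. *)
have definable phi x y : vars_below n phi -> code x = code y ->
    eval v phi x -> eval v phi y.
  move=> nphi /setP codeE; have [psi psit ->] := s_rep _ nphi; last by [].
  have it : index psi t < size t by rewrite index_mem.
  have := codeE (Ordinal it); rewrite !inE /= nth_index // => E px.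
  by apply/asboolP; rewrite -E; apply/asboolP.
(* Conversely, the conjunction of the literals over [t] true at [x] defines the fiber of [x]. *)
have fiberE x : exists2 chi, vars_below n chi & eval v chi = code @^-1` [set code x].
  pose lit psi := if `[< eval v psi x >] then psi else Neg psi.
  have lit_below : all (vars_below n) (map lit t).
    rewrite all_map; apply/allP => psi /(allP s_below) /=.
    by rewrite /lit; case: asboolP => //= _ ->.
  have lit_x psi : eval v (lit psi) x.
    by rewrite /lit; case: asboolP => // ? ; rewrite eval_Neg.
  exists (bigAnd (map lit t)); first exact: vars_below_bigAnd.
  apply/seteqP; split=> y /=; last first.
    move=> codeE; apply: (definable _ x y) => //; first exact: vars_below_bigAnd.
    by apply/eval_bigAnd => _ /mapP[psi _ ->].
  move=> /eval_bigAnd H; apply/setP => i; rewrite !inE.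
  have : eval v (lit (nth Bot t i)) y by apply/H/map_f/mem_nth.
  rewrite /lit; case: (asboolP (eval v _ x)) => _; first by move=> ?; apply/asboolP.
  by rewrite eval_Neg => ?; apply/asboolPn.
exists (fibers code); split.
- exact: partition_fibers.
- move=> _ [x _ <-]; have [coverQ _ _] := Qpart.
  have [V QV Vx] : cover Q id x by rewrite coverQ.
  have [i /= ltin viV] := Qv _ QV.
  exists V => // y /= codeE; rewrite -viV.
  by apply: (definable (Var i) x y); rewrite //= viV.
- exact: card_fibers.
(* If [chi] defines a block, [Dia d chi] defines its image under [op d], which is thus a union of
   blocks. *)
- move=> d _ _ [x _ <-] [y _ <-] [z [/= zy zx]] w /= wy.
  have [chi nchi chiE] := fiberE x; rewrite -chiE in zx *.
  by apply: (definable (Dia d chi) z w) => //; rewrite zy wy.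
Qed.

(** Tunedness makes the image of one block a union of blocks; as [T] is finite, binary additivity
    carries this over to all unions of blocks. *)
Lemma tuned_preimage (X : Type) (T : finType) (h : X -> T)
    (g : set X -> set X) (W : {set T}) :
  g set0 = set0 -> (forall U V, g (U `|` V) = g U `|` g V) ->
  tuned_for g (fibers h) ->
  exists W' : {set T}, g [set x | h x \in W] = [set x | h x \in W'].
Proof.
move=> g0 gU tun.
have gW : g [set x | h x \in W] = \bigcup_(t in [set` W]) g (h @^-1` [set t]).
  rewrite bigcup_pred -(big_morph g gU g0) -bigcup_pred; congr (g _).
  by apply/seteqP; split=> [x xW|x [t tW] /= ->] //; exists (h x).
pose G := g [set x | h x \in W].
exists [set t : T | `[< exists2 x, h x = t & G x >]]%SET; rewrite -/G.
apply/seteqP; split=> x /=; first by move=> gx; rewrite inE; apply/asboolP; exists x.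
rewrite inE => /asboolP[y hyx]; rewrite /G gW => -[t tW gy].
(* A label [t] outside the range of [h] gives no block to apply tunedness to; there [g0] contradicts
   [gy]. *)
exists t => //; have [[z /= zt]|] := EM (h @^-1` [set t] !=set0); last first.
  by move=> /set0P/negP/negPn/eqP ht0; move: gy; rewrite ht0 g0.
have := tun (h @^-1` [set t]) (h @^-1` [set h y]); apply => //.
- by exists z => //; rewrite zt.
- by exists y.
- by exists y.
Qed.

Section Tables.
Variables (Al T : finType) (k : nat).

(** A candidate algebra on [{set T}] with values for [k] variables. Tables form a finite type
    because [Al] and [T] are finite. *)
Definition table : Type :=
  ({ffun Al -> {ffun {set T} -> {set T}}} * {ffun 'I_k -> {set T}})%type.

Fixpoint table_eval (M : table) (phi : formula Al) : {set T} :=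
  match phi with
  | Var i => if insub i is Some j then M.2 j else finset.set0
  | Bot => finset.set0
  | Imp phi1 phi2 => (~: table_eval M phi1 :|: table_eval M phi2)%SET
  | Dia d phi1 => M.1 d (table_eval M phi1)
  end.

(** Preimage under [h] commutes with the Boolean operations and, by hypothesis, with the modal ones.
    The bound on variables excludes the default value in [table_eval]. *)
Lemma eval_table (C : powerset_algebra Al) (v : nat -> set (carrier C))
    (h : carrier C -> T) (M : table) (phi : formula Al) :
  (forall d (W : {set T}), op d [set x | h x \in W] = [set x | h x \in M.1 d W]) ->
  (forall i : 'I_k, v i = [set x | h x \in M.2 i]) ->
  vars_below k phi -> eval v phi = [set x | h x \in table_eval M phi].
Proof.
move=> hop hv; elim: phi => [i|_|phi IH psi IH'|d phi IH] /=.
- by move=> ik; rewrite insubT (hv (Ordinal ik)).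
- by apply/seteqP; split=> x //=; rewrite inE.
- move=> /andP[/IH-> /IH'->]; apply/seteqP; split=> x /=; rewrite !inE.
    by move=> [/negP->|->]; rewrite ?orbT.
  by move=> /orP[/negP|]; [left|right].
- by move=> /IH->.
Qed.

Lemma exists_table (C : powerset_algebra Al) (v : nat -> set (carrier C))
    (h : carrier C -> T) :
  tuned (fibers h) -> (forall (i : 'I_k) x y, h x = h y -> v i x -> v i y) ->
  exists M : table, forall phi,
    vars_below k phi -> eval v phi = [set x | h x \in table_eval M phi].
Proof.
move=> tun hv.
have [F FP] := choice (fun dW : Al * {set T} =>
  tuned_preimage dW.2 (op_set0 C dW.1) (@op_setU _ C dW.1) (tun dW.1)).
pose w (i : 'I_k) := [set t : T | `[< exists2 x, h x = t & v i x >]]%SET.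
exists ([ffun d => [ffun W => F (d, W)]], [ffun i => w i]) => phi.
apply: eval_table => [d W|i]; rewrite !ffunE; first exact: (FP (d, W)).
apply/seteqP; split=> x /=; rewrite inE; last by move=> /asboolP[y]; exact: hv.
by move=> vx; apply/asboolP; exists x.
Qed.

End Tables.

Lemma tunable_locally_tabular (Al : finType) (A : powerset_algebra Al -> Prop) :
  uniformly_tunable A -> locally_tabular (Log A).
Proof.
move=> [f fA] k S S_below S_neq.
(* A valuation of [k] variables cuts the carrier into at most [K] blocks, possibly fewer; since [f]
   need not be monotone, [m] is a maximum over all these counts. *)
pose K := #|{set 'I_k}|; pose m := \max_(n < K.+1) f n.
(* [F] has a finite codomain, so its injectivity on [S] suffices. *)
pose F phi := [ffun M : table Al 'I_m k => table_eval M phi].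
have Finj : {in S &, injective F}.
  move=> phi psi; rewrite !inE => Sphi Spsi Fe; apply: contrapT => neq.
  apply: (S_neq _ _ Sphi Spsi neq); apply/LogIffP => C v AC.
  (* Each [v i] with [i < k] is a union of fibers of [q], hence of blocks of any refinement. *)
  pose q x := [set i : 'I_k | `[< v i x >]]%SET.
  have /finite_setP[n qn] : finite_set (fibers q).
    by apply/finite_set_leP; exists K; exact: card_fibers.
  have nk : n <= K by rewrite -card_le_II -(card_le_eql qn); exact: card_fibers.
  have [P [Ppart Pref Pcard Ptun]] := fA C AC n _ (partition_fibers q) qn.
  have Pm : P #<= `I_m.
    apply: (card_le_trans Pcard); rewrite card_le_II.
    exact: (@leq_bigmax _ (fun n : 'I_K.+1 => f n) (Ordinal (nk : n < K.+1))).
  have [h hP] := partition_indexed Ppart Pm; subst P.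
  have hv (i : 'I_k) x y : h x = h y -> v i x -> v i y.
    move=> hxy.
    have [_ [z _ <-] sub] := Pref (h @^-1` [set h x]) (ex_intro2 _ _ x I erefl).
    have /setP/(_ i) : q x = q y by rewrite (sub x erefl) (sub y (esym hxy)).
    by rewrite !inE => E /asboolP; rewrite E => /asboolP.
  have [M ME] := exists_table Ptun hv.
  rewrite !ME ?S_below //.
  by have /ffunP/(_ M) := Fe; rewrite !ffunE => ->.
by rewrite -(eq_finite_set (inj_card_eq Finj)); exact: finite_finset.
Qed.

Theorem theorem4p7 (Al : finType) (A : powerset_algebra Al -> Prop) :
  locally_tabular (Log A) <-> uniformly_tunable A.
Proof.
by split; [exact: locally_tabular_tunable|exact: tunable_locally_tabular].
Qed.
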